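(* $t(3)=t(4)=4$. That is, for each $k\in\{3,4\}$, the minimum size of an alphabet over which there exists an infinite word avoiding $k$-tangrams is exactly $4$.
   Context: Words are sequences of letters over a finite alphabet; a factor of a word is a finite block of consecutive letters of it. A tangram is a nonempty finite word in which every letter of the alphabet occurs an even number of times (possibly zero). The cut number of a tangram $w$ is the minimum number of cuts needed so that the resulting parts can be rearranged into two identical words. Precisely, it is the least integer $c\ge 1$ such that $w$ can be written as a concatenation $w=p_1p_2\cdots p_{c+1}$ of $c+1$ nonempty words for which there exist a permutation $\sigma$ of $\{1,\dots,c+1\}$ and an index $1\le j\le c$ with $p_{\sigma(1)}\cdots p_{\sigma(j)}=p_{\sigma(j+1)}\cdots p_{\sigma(c+1)}$ (equality of words). For $k\ge 1$, a $k$-tangram is a tangram whose cut number is at most $k$; in particular the $1$-tangrams are exactly the squares $uu$ with $u$ nonempty. An infinite word (indexed by $\mathbb{N}$) avoids $k$-tangrams if none of its factors is a $k$-tangram. For $k\ge 1$, $t(k)$ denotes the minimum size of an alphabet over which there exists an infinite word avoiding $k$-tangrams. *)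

(* Defs.v *)
From mathcomp Require Import all_boot.

Set Implicit Arguments.
Unset Strict Implicit.
Unset Printing Implicit Defensive.

Definition is_least (P : nat -> Prop) (n : nat) : Prop :=
  P n /\ forall m : nat, P m -> n <= m.

Definition tangram (A : finType) (w : seq A) : Prop :=
  w <> [::] /\ forall a : A, ~~ odd (count_mem a w).

(* [ps] lists the c + 1 parts of [w]; [qs] is their rearrangement, of which
   the first [j] parts and the remaining ones spell the same word. *)
Definition splits_with_cuts (A : finType) (w : seq A) (c : nat) : Prop :=
  exists ps qs : seq (seq A),
    [/\ size ps = c.+1, [::] \notin ps, flatten ps = w, perm_eq qs ps
      & exists2 j : nat, 1 <= j <= c
          & flatten (take j qs) = flatten (drop j qs)].

(* Stated as a relation; every tangram has exactly one cut number, since it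
   can always be cut into single letters. *)
Definition is_cut_number (A : finType) (w : seq A) (c : nat) : Prop :=
  is_least (fun c' : nat => 1 <= c' /\ splits_with_cuts w c') c.

Definition ktangram (A : finType) (k : nat) (w : seq A) : Prop :=
  tangram w /\ exists2 c : nat, is_cut_number w c & c <= k.

Definition factor (A : finType) (x : nat -> A) (m l : nat) : seq A :=
  [seq x i | i <- iota m l].

Definition avoids_ktangrams (A : finType) (k : nat) (x : nat -> A) : Prop :=
  forall m l : nat, ~ ktangram k (factor x m l).

(* [is_t k n] reads t(k) = n; ['I_n] is the alphabet with n letters. *)
Definition is_t (k n : nat) : Prop :=
  is_least (fun s : nat => exists x : nat -> 'I_s, avoids_ktangrams k x) n.

(* Main.v *)
Require Import Defs.
From mathcomp Require Import all_boot.
From mathcomp Require Import zify.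

Set Implicit Arguments.
Unset Strict Implicit.
Unset Printing Implicit Defensive.

(** Lower bound. Among any eight consecutive letters over three symbols there
    is a square of period at most 4 or one of the shapes abacbc, abcacb,
    abcbac, and each of these can be cut at most three times into two equal
    words ([tangram_prefixP], [ternary_check]). So three letters do not suffice
    even for 3-tangrams, and a fortiori not for 4-tangrams.

    Upper bound. If at most four cuts turn a word into two copies of a word X,
    the pieces factor X in two ways, with at most three inner cut points in all.
    The common refinement of the two factorizations has at most four blocks, so
    the word is a concatenation of at most eight blocks, each of at most four
    words occurring twice ([cuts_doubled]). Call such a word doubled.

    Let x_i be the lengths of the four words, p_i the distance between the two
    copies of the i-th one, and s the sum of the x_i. Given two of the words,
    the copies of either that start between the two copies of the other are at
    most two in all, hence sum x_i p_i <= s^2 ([doubled_matching]), whereas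
    s^2 <= 4 sum x_i^2 by Cauchy-Schwarz. Therefore a word all of whose repetitions, that is pairs of
    equal factors of length l at distance p, satisfy 4 l < p contains no doubled
    factor; if only the repetitions with l >= 6 do, then s <= 50 ([sum_le50]),
    and finitely many factors remain to be inspected.

    Any infinite word over four letters has short repetitions with p <= 4 l, but
    long ones can be kept sparse. The word [letter] is the concatenation over n
    of blocks of length 50 that depend on n mod 12 and on one bit [zbit n]. The
    bits form the fixed point of a 13-uniform morphism, and repetitions of the
    bits at distances divisible by 12 satisfy 4 l + 4 <= p: as 13 = 1 modulo 12,
    desubstitution turns such a repetition into a shorter one of the same kind
    ([zbit_run]). Every factor of length 19 of [letter] determines its position
    modulo 600, so a long repetition sits at a distance 600 k, and comparing one
    well-chosen letter per block turns it into a repetition of the bits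
    ([letter_run]). The remaining short cases are settled by computation over
    all windows of three consecutive blocks ([run_check], [doubled_check]). *)

(** * From cuts to doubled words *)

Section Doubled.
Variable T : eqType.
Implicit Types (w v : seq T) (bs vs : seq (seq T)).

(** Instances of patterns with at most [n] variables, each occurring twice;
    the variables may be empty words. *)
Definition doubled (n : nat) w : Prop :=
  exists bs vs, [/\ flatten bs = w, perm_eq bs (vs ++ vs) & size vs <= n].

(** Regrouping the parts permutes words that are images of finer data, blocks
    or labels; the permutation is pulled back to these. *)
Lemma perm_map_lift (S : eqType) (f : S -> T) (s : seq T) (t : seq S) :
  perm_eq s (map f t) -> exists2 t', perm_eq t' t & s = map f t'.
Proof.
case: t => [|t0 t]; first by move=> /perm_nilP ->; exists [::].
move=> /(perm_iotaP (f t0)) [Is]; rewrite size_map => pI ->.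
exists (map (nth t0 (t0 :: t)) Is).
  apply/(perm_iotaP t0); by exists Is.
rewrite -map_comp; apply/eq_in_map => i; rewrite (perm_mem pI) mem_iota add0n.
by move=> lti; rewrite (nth_map t0).
Qed.

(** Cutting one word at the cut points of both factorizations refines both; two
    factorizations with [a] and [b] factors have [a + b - 2] inner cut points. *)
Lemma common_refinement (P Q : seq (seq T)) :
  flatten P = flatten Q ->
  exists PP QQ : seq (seq (seq T)),
    [/\ map flatten PP = P, map flatten QQ = Q, flatten PP = flatten QQ
      & size (flatten PP) <= (size P + size Q).-1].
Proof.
have flatten_nil : forall R : seq (seq T), flatten R = [::] ->
    map flatten (map (fun=> [::] : seq (seq T)) R) = R.
  by elim=> [|[|//] R IH] //= /IH ->.
have flatten_nil2 : forall R : seq (seq T),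
    flatten (map (fun=> [::] : seq (seq T)) R) = [::].
  by elim.
have [n] := ubnP (size P + size Q); elim: n P Q => // n IH P Q.
case: P => [|p P]; last case: Q => [|q Q].
- move=> _ /esym Q0; exists [::], (map (fun=> [::]) Q).
  by rewrite flatten_nil ?flatten_nil2.
- move=> _ P0; exists (map (fun=> [::]) (p :: P)), [::].
  by rewrite flatten_nil ?flatten_nil2.
rewrite /= ltnS => ltn eqPQ.
(* Split off the shorter of the two first factors. *)
wlog le_pq : p q P Q ltn eqPQ / size p <= size q => [wl|].
  case: (leqP (size p) (size q)) => [|/ltnW] le; first exact: wl.
  have ltn' : (size Q).+1 + (size P).+1 <= n by rewrite addnC.
  have [QQ [PP [e1 e2 e3 sz]]] := wl q p Q P ltn' (esym eqPQ) le.
  exists PP, QQ; split=> //.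
  by move: sz; rewrite e3 /=; lia.
have Dq : q = p ++ drop (size p) q.
  have := congr1 (take (size p)) eqPQ.
  rewrite take_size_cat // take_cat.
  case: ltngtP le_pq => // [lt|eq] _ Dp; last first.
    rewrite eq subnn take0 cats0 in Dp; by rewrite eq drop_size cats0.
  by rewrite [X in X ++ _]Dp cat_take_drop.
move: eqPQ; rewrite [in X in X -> _]Dq -catA => /(congr1 (drop (size p))).
rewrite !drop_size_cat // => eqPQ.
have [|PP [[|r QQ] [// e1 e2 e3 sz]]] := IH P (drop (size p) q :: Q) _ eqPQ.
  by move: ltn => /=; lia.
case: e2 => e2 e2'.
exists ([:: p] :: PP), ((p :: r) :: QQ); split=> /=.
- by rewrite cats0 e1.
- by rewrite e2 -Dq e2'.
- by rewrite e3.
- by move: sz => /=; lia.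
Qed.

End Doubled.

Lemma doubled_map (T S : eqType) (f : T -> S) n w :
  doubled n w -> doubled n (map f w).
Proof.
move=> [bs [vs [<- pbs szv]]]; exists (map (map f) bs), (map (map f) vs).
by rewrite -map_flatten -map_cat perm_map // size_map.
Qed.

Lemma doubled_nonempty (T : eqType) n (w : seq T) : doubled n w ->
  exists bs vs, [/\ flatten bs = w, perm_eq bs (vs ++ vs), size vs <= n
    & [::] \notin bs].
Proof.
move=> [bs [vs [ew pbs szv]]].
exists (filter (predC1 [::]) bs), (filter (predC1 [::]) vs); split.
- by rewrite -ew; elim: (bs) => //= -[|a b] bs' /= ->.
- by rewrite -filter_cat perm_filter.
- by rewrite size_filter (leq_trans (count_size _ _)).
- by rewrite mem_filter.
Qed.

(** The two factorizations of the half-word have [c.+1] factors in all, so their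
    common refinement has at most [c] blocks. *)
Lemma cuts_doubled (A : finType) (w : seq A) c :
  splits_with_cuts w c -> doubled c w.
Proof.
move=> [ps [qs [szp _ <- pqp [j /andP [j1 jc] eqh]]]].
have [PP [QQ [eP eQ ePQ sz]]] := common_refinement eqh.
have Dqs : qs = map flatten (PP ++ QQ) by rewrite map_cat eP eQ cat_take_drop.
have [|RR pR eR] := @perm_map_lift _ _ flatten ps (PP ++ QQ).
  by rewrite -Dqs perm_sym.
exists (flatten RR), (flatten PP); split.
- by rewrite eR; elim: RR {pR eR} => //= a R IH; rewrite flatten_cat IH.
- by rewrite {2}ePQ -flatten_cat perm_flatten.
- move: sz; rewrite -size_cat cat_take_drop (perm_size pqp) szp; lia.
Qed.

(** * Distances between the two copies of a variable *)

(** Reading a list in which the label [i] occurs twice, [inside false i] keeps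
    what is met from the first [i], included, up to the second, excluded; the
    Boolean tells whether [i] is open. These are the blocks that separate the
    starting points of the two copies of block [i]. *)
Fixpoint inside (b : bool) (i : nat) (ls : seq nat) : seq nat :=
  if ls is k :: t then
    let b' := b (+) (k == i) in
    (if b' then [:: k] else [::]) ++ inside b' i t
  else [::].

Lemma inside_cat b i l t : i \notin l ->
  inside b i (l ++ t) = (if b then l else [::]) ++ inside b i t.
Proof.
elim: l => [|k l IH] /=; first by case: b.
rewrite inE negb_or eq_sym => /andP [/negbTE ki il].
by rewrite ki addbF IH //; case: (b).
Qed.

Lemma inside_split i l1 l2 l3 : i \notin l1 -> i \notin l2 -> i \notin l3 ->
  inside false i (l1 ++ i :: l2 ++ i :: l3) = i :: l2.
Proof.
move=> h1 h2 h3; rewrite inside_cat //= eqxx /= inside_cat //= eqxx /=.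
by rewrite -[l3]cats0 inside_cat //= cats0.
Qed.

Lemma inside_self i ls : count_mem i ls <= 2 ->
  count_mem i (inside (odd (count_mem i ls)) i ls) = (count_mem i ls)./2.
Proof.
elim: ls => [|k ls IH] //=; case: (eqVneq k i) => [->|ki] /=.
  rewrite add1n /=; move=> le.
  rewrite addbT negbK count_cat IH; last exact: ltnW.
  by case: (count_mem i ls) le => [|[|c]] //=; rewrite eqxx.
rewrite add0n addbF count_cat => /IH ->.
by case: odd => //=; rewrite (negbTE ki).
Qed.

(** The parity of the number of copies still to come tells whether a label is
    open, which makes the statement inductive. With both copies of both labels
    to come, the patterns ijij and ijji show that the bound 2 is attained. *)
Lemma inside_pair i j ls : i != j ->
  count_mem i ls <= 2 -> count_mem j ls <= 2 ->
  count_mem j (inside (odd (count_mem i ls)) i ls)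
  + count_mem i (inside (odd (count_mem j ls)) j ls)
  <= (if (count_mem i ls == 0) || (count_mem j ls == 0) then 0
      else if (count_mem i ls == 1) && (count_mem j ls == 1) then 1 else 2).
Proof.
move=> ij; elim: ls => [|k ls IH] //=.
case: (eqVneq k i) => [->|ki].
  rewrite (negbTE ij) /= !add0n add1n /= addbT negbK addbF !count_cat.
  move=> lei lej; have {}IH := IH (ltnW lei) lej.
  move: IH lei lej.
  set a := count_mem i ls; set b := count_mem j ls.
  move: (count_mem j (inside _ i ls)) (count_mem i (inside _ j ls)) => u v.
  move: a b => [|[|[|a]]] [|[|[|b]]] //=; rewrite ?eqxx ?(negbTE ij) //=; lia.
case: (eqVneq k j) => [->|kj] /=.
  rewrite !add0n add1n /= addbT negbK addbF !count_cat.
  move=> lei lej; have {}IH := IH lei (ltnW lej).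
  move: IH lei lej.
  set a := count_mem i ls; set b := count_mem j ls.
  move: (count_mem j (inside _ i ls)) (count_mem i (inside _ j ls)) => u v.
  move: a b => [|[|[|a]]] [|[|[|b]]] //=; rewrite ?eqxx ?(negbTE ij) //=; lia.
rewrite !add0n !addbF !count_cat => lei lej.
have {}IH := IH lei lej; apply: leq_trans IH.
by do 2!case: odd => //=; rewrite ?(negbTE ki) ?(negbTE kj).
Qed.

Lemma inside_both i j ls : count_mem i ls = 2 -> count_mem j ls = 2 ->
  count_mem j (inside false i ls) + count_mem i (inside false j ls) <= 2.
Proof.
move=> ci cj; case: (eqVneq i j) => [<-|ij].
  by have := @inside_self i ls; rewrite ci /= => ->.
by have := @inside_pair i j ls ij; rewrite ci cj /=; exact.
Qed.

Lemma sumn_count (X : nat -> nat) n (s : seq nat) : all (fun k => k < n) s ->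
  sumn (map X s) = \sum_(j < n) X j * count_mem (val j) s.
Proof.
elim: s => [|k s IH] /=; first by rewrite big1 // => j _; rewrite muln0.
move=> /andP [kn /IH ->].
under [RHS]eq_bigr => j _ do rewrite mulnDr.
rewrite big_split /=; congr (_ + _).
rewrite (bigD1 (Ordinal kn)) //= eqxx muln1 big1 ?addn0 // => j.
by rewrite -val_eqE /= eq_sym => /negbTE ->; rewrite muln0.
Qed.

Lemma inside_sub b i ls k : k \in inside b i ls -> k \in ls.
Proof.
elim: ls b => [|a ls IH] b //=; rewrite mem_cat inE => /orP [|/IH ->].
  by case: ifP => // _; rewrite inE => ->.
by rewrite orbT.
Qed.

(** Expanding each distance [per i] as the sum of the lengths of the blocks met
    while [i] is open writes [x i * per i] as a sum of products [x i * x j] with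
    multiplicities. By [inside_both] the multiplicities of the pairs (i, j) and
    (j, i) add up to at most 2, as in the expansion of the square. *)
Lemma doubled_matching (T : eqType) (x0 : T) n (w : seq T) : doubled n w ->
  exists x per : 'I_n -> nat,
    [/\ size w = (\sum_i x i).*2,
        \sum_i x i * per i <= (\sum_i x i) ^ 2,
        forall i, x i <= per i
      & forall i, exists2 a, a + per i + x i <= size w
          & forall k, k < x i -> nth x0 w (a + k) = nth x0 w (a + per i + k)].
Proof.
move=> [bs0 [vs0 [ew pbs szv]]].
(* Missing variables are replaced by empty ones, and blocks by labels. *)
pose V := nth [::] vs0.
have Dvs : vs0 ++ nseq (n - size vs0) [::] = map V (iota 0 n).
  apply: (@eq_from_nth _ [::]).
    by rewrite size_cat size_nseq size_map size_iota subnKC.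
  move=> i; rewrite size_cat size_nseq subnKC // => lti.
  rewrite (nth_map 0) ?size_iota // nth_iota // add0n nth_cat nth_nseq.
  by case: ltnP => // le; rewrite if_same /V nth_default.
pose E := nseq (n - size vs0) ([::] : seq T).
have pE : perm_eq (bs0 ++ (E ++ E)) (map V (iota 0 n ++ iota 0 n)).
  rewrite map_cat -Dvs -/E.
  apply: (@perm_trans _ ((vs0 ++ vs0) ++ (E ++ E))); first by rewrite perm_cat2r.
  by rewrite -!catA perm_cat2l perm_catCA.
have [ls pls els] := perm_map_lift pE.
have fE : forall m, flatten (nseq m ([::] : seq T)) = [::] by elim.
have Dw : w = flatten (map V ls).
  by rewrite -els !flatten_cat !fE !cats0 ew.
have cnt : forall i, i < n -> count_mem i ls = 2.
  move=> i lti; rewrite (permP pls) count_cat !count_uniq_mem ?iota_uniq //.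
  by rewrite mem_iota lti.
have alln : all (fun k => k < n) ls.
  by apply/allP => k; rewrite (perm_mem pls) mem_cat mem_iota orbb.
pose X k := size (V k).
pose per (i : nat) := sumn (map X (inside false i ls)).
have dec : forall i, i < n -> exists l1 l2 l3,
   [/\ ls = l1 ++ i :: l2 ++ i :: l3 & inside false i ls = i :: l2].
  move=> i lti; have c2 := cnt i lti.
  have consc s : count_mem i (i :: s) = (count_mem i s).+1.
    by rewrite /= eqxx.
  have notin s : count_mem i s = 0 -> i \notin s.
    by move=> c0; rewrite -has_pred1 has_count c0.
  have isin s : 0 < count_mem i s -> i \in s by rewrite -has_pred1 has_count.
  have : i \in ls by rewrite isin // c2.
  move: c2 => /[swap] /splitPr [l1 l'].
  rewrite count_cat consc => c2.
  have [c1|c1] := posnP (count_mem i l1).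
    have il' : i \in l' by apply: isin; lia.
    case/splitPr: il' c2 => l2 l3; rewrite count_cat consc => c2.
    exists l1, l2, l3; split=> //.
    by apply: inside_split; apply: notin; lia.
  case/splitPr: (isin _ c1) c2 => la lb; rewrite count_cat consc => c2.
  exists la, lb, l'; rewrite -catA; split=> //=.
  by apply: inside_split; apply: notin; lia.
have szw : size w = (\sum_(i < n) X i).*2.
  rewrite Dw size_flatten /shape -map_comp -/X (sumn_count X alln).
  under eq_bigr => j _ do rewrite (cnt _ (ltn_ord j)).
  by rewrite -big_distrl /= muln2.
exists (fun i => X i), (fun i => per i); split=> // [|i|i].
- pose a (i j : 'I_n) := X i * (X j * count_mem (val j) (inside false i ls)).
  have -> : \sum_(i < n) X i * per i = \sum_i \sum_j a i j.
    apply: eq_bigr => i _; rewrite -big_distrr /=; congr (_ * _).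
    rewrite /per (@sumn_count X n) //; apply/allP => k.
    by move/inside_sub/(allP alln).
  rewrite -leq_double -addnn {2}exchange_big -big_split /=.
  rewrite -mul2n -mulnn big_distrl big_distrr /=.
  apply: leq_sum => i _; rewrite -big_split big_distrr big_distrr /=.
  apply: leq_sum => j _; rewrite /a.
  rewrite [X in _ + X]mulnCA !mulnA -mulnDr [_ * X j * _]mulnC -mulnA leq_mul //.
  exact: inside_both (cnt i (ltn_ord i)) (cnt j (ltn_ord j)).
- have [l1 [l2 [l3 [_ e]]]] := dec i (ltn_ord i).
  by rewrite /per e /= leq_addr.
have [l1 [l2 [l3 [els' e]]]] := dec i (ltn_ord i).
pose A := flatten (map V l1); pose M := flatten (map V l2).
have Dper : per i = size (V i ++ M).
  rewrite /per e /= size_cat size_flatten /shape -map_comp; congr (_ + _).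
have Dw' : w = A ++ (V i ++ M) ++ (V i ++ flatten (map V l3)).
  by rewrite Dw els' map_cat flatten_cat /= map_cat flatten_cat /= !catA.
exists (size A); rewrite Dw' Dper.
  by rewrite !size_cat /X; lia.
have nth_skip (s t : seq T) k : nth x0 (s ++ t) (size s + k) = nth x0 t k.
  by rewrite nth_cat ltnNge leq_addr addKn.
move=> k ltk; rewrite -addnA !nth_skip !nth_cat.
by rewrite size_cat ltn_addr // ltk.
Qed.

(** * Doubled words with sparse long repetitions are short *)

(** Three times [4 * (a^2 + b^2 + c^2 + d^2) - (a + b + c + d)^2] is
    [(b + c + d - 3 * a)^2] plus four times the squares of the differences of
    [b], [c] and [d]; so [b + c + d] exceeds [3 * a] by at most 30. *)
Lemma balanced4 a b c d :
  4 * (a * a + b * b + c * c + d * d) <= (a + b + c + d) * (a + b + c + d) + 300 ->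
  a <= 5 -> a + b + c + d <= 50.
Proof.
move=> le a5.
have := (nat_Cauchy b c, nat_Cauchy b d, nat_Cauchy c d).
rewrite -!mulnn => -[[[bc _] [bd _]] [cd _]].
have near : 9 * (a * a) + (b + c + d) * (b + c + d)
    <= 6 * (a * (b + c + d)) + 900 by lia.
rewrite leqNgt; apply/negP => gt.
have [t Dt] : exists t, b + c + d = 3 * a + (31 + t).
  by exists (b + c + d - 3 * a - 31); lia.
move: near; rewrite Dt => near.
have : (31 + t) * (31 + t) <= 900 by lia.
nia.
Qed.

(** A length at most 5 may violate [4 * x < per], but [x <= per] keeps
    [4 * x^2 <= x * per + 75]; over four variables the total defect is at most
    300. If no length is that small, Cauchy-Schwarz is contradicted outright. *)
Lemma sum_le50 (x per : 'I_4 -> nat) :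
  \sum_i x i * per i <= (\sum_i x i) ^ 2 ->
  (forall i, x i <= per i) -> (forall i, 5 < x i -> 4 * x i < per i) ->
  \sum_i x i <= 50.
Proof.
move=> le lo hi.
have small i : x i <= 5 -> 4 * (x i * x i) <= x i * per i + 75.
  by move: (lo i) => ? ?; nia.
have big i : 5 < x i -> 4 * (x i * x i) + x i <= x i * per i.
  by move/hi => ?; nia.
have sq i : 4 * (x i * x i) <= x i * per i + 75.
  by have [/small|/big] := leqP (x i) 5; lia.
move: le; rewrite !big_ord_recl !big_ord0 !addn0 -mulnn.
move: (small ord0) (big ord0) (sq ord0) => s0 b0 q0.
set i1 := lift _ _; move: (small i1) (big i1) (sq i1) => s1 b1 q1.
set i2 := lift _ _; move: (small i2) (big i2) (sq i2) => s2 b2 q2.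
set i3 := lift _ _; move: (small i3) (big i3) (sq i3) => s3 b3 q3.
move: (x ord0) (x i1) (x i2) (x i3) (per ord0) (per i1) (per i2) (per i3)
  s0 b0 q0 s1 b1 q1 s2 b2 q2 s3 b3 q3 => a b c d pa pb pc pd.
move: (a * pa) (b * pb) (c * pc) (d * pd) => ta tb tc td.
move=> s0 b0 q0 s1 b1 q1 s2 b2 q2 s3 b3 q3 le.
have bal : 4 * (a * a + b * b + c * c + d * d)
    <= (a + (b + (c + d))) * (a + (b + (c + d))) + 300 by lia.
have [a5|a5] := leqP a 5; first by have := @balanced4 a b c d; lia.
have [b5|b5] := leqP b 5; first by have := @balanced4 b a c d; lia.
have [c5|c5] := leqP c 5; first by have := @balanced4 c a b d; lia.
have [d5|d5] := leqP d 5; first by have := @balanced4 d a b c; lia.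
have := (nat_Cauchy a b, nat_Cauchy a c, nat_Cauchy a d,
         nat_Cauchy b c, nat_Cauchy b d, nat_Cauchy c d).
rewrite -!mulnn => -[[[[[[ab _] [ac _]] [ad _]] [bc _]] [bd _]] [cd _]].
lia.
Qed.

(** * Searching for doubled prefixes *)

Fixpoint lcp (v w : seq nat) : nat :=
  match v, w with
  | a :: v', b :: w' => if a == b then (lcp v' w').+1 else 0
  | _, _ => 0
  end.

(** The largest length of a prefix of [v] that occurs in [w]. *)
Fixpoint reach (v w : seq nat) : nat :=
  if w is _ :: w' then maxn (lcp v w) (reach v w') else 0.

(** A variable whose first copy starts at a given letter occurs again later, so
    its length is bounded by the number stored next to that letter. Computing
    these bounds once per word is what keeps the search below small. *)
Fixpoint annot (w : seq nat) : seq (nat * nat) :=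
  if w is a :: w' then (a, reach w w') :: annot w' else [::].

(* Comparisons use [if] so that evaluation stops at the first mismatch. *)
Fixpoint strip (v : seq nat) (w : seq (nat * nat)) : option (seq (nat * nat)) :=
  match v, w with
  | [::], _ => Some w
  | a :: v', b :: w' => if a == b.1 then strip v' w' else None
  | _, _ => None
  end.

Fixpoint grow (k : seq nat -> seq (nat * nat) -> bool) m u w : bool :=
  match m, w with
  | m'.+1, a :: w' =>
    let u' := rcons u a.1 in k u' w' || grow k m' u' w'
  | _, _ => false
  end.

(** Depth-first search for a doubled prefix, from left to right: the next block
    is the second copy of a pending variable or the first copy of one of the [n]
    variables not used yet. *)
Fixpoint starts_doubled fuel n (pend : seq (seq nat)) w : bool :=
  if fuel is f.+1 then
    has (fun v => if strip v w is Some w' then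
                    let pend' := rem v pend in
                    nilp pend' || starts_doubled f n pend' w'
                  else false) pend
    || (if n is n'.+1 then
          grow (fun u => starts_doubled f n' (u :: pend)) (head (0, 0) w).2 [::] w
        else false)
  else false.

Lemma lcp_prefix v w s t : v ++ s = w -> size v <= lcp w (v ++ t).
Proof. by move=> <-; elim: v => //= a v IH; rewrite eqxx. Qed.

Lemma reach_infix v s x t : v != [::] -> size v <= reach (v ++ s) (x ++ v ++ t).
Proof.
case: v => // a v _; elim: x => [|b x IH]; rewrite [_ ++ _ ++ _]/= /reach -/reach.
  by rewrite leq_max -cat_cons (@lcp_prefix (a :: v) _ s).
by rewrite leq_max IH orbT.
Qed.

Lemma drop_annot n w : drop n (annot w) = annot (drop n w).
Proof. by elim: w n => [|a w IH] [|n] //=. Qed.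

Lemma head_annot v x t : v != [::] ->
  size v <= (head (0, 0) (annot (v ++ x ++ v ++ t))).2.
Proof.
case: v => // a v _.
by have := @reach_infix (a :: v) (x ++ (a :: v) ++ t) (v ++ x) t isT; rewrite -catA.
Qed.

Lemma strip_cat v t : strip v (annot (v ++ t)) = Some (annot t).
Proof. by elim: v => //= a v; rewrite eqxx. Qed.

Lemma grow_cat (k : seq nat -> seq (nat * nat) -> bool) m u v t :
  v != [::] -> size v <= m -> k (u ++ v) (annot t) -> grow k m u (annot (v ++ t)).
Proof.
elim: v m u => // a v IH [|m] u _ //=; rewrite ltnS => le kuv.
case: v => [|b v] in IH le kuv *; first by rewrite -cats1 kuv.
by rewrite IH ?orbT // cat_rcons.
Qed.

(** Completeness of the search. The pending variables [pend] have one copy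
    to come, the variables [vs] two. *)
Lemma starts_doubledP bs pend vs n fuel t :
  perm_eq bs (pend ++ vs ++ vs) -> [::] \notin bs -> bs != [::] ->
  size vs <= n -> size bs <= fuel ->
  starts_doubled fuel n pend (annot (flatten bs ++ t)).
Proof.
elim: bs pend vs n fuel => // b bs IH pend vs n [|fuel] // pbs.
rewrite inE negb_or eq_sym => /andP [b0 nbs] _ szv le.
have : b \in pend ++ vs ++ vs by rewrite -(perm_mem pbs) mem_head.
rewrite !mem_cat orbb => /orP [bp|bv] /=.
  apply/orP; left; apply/hasP; exists b => //.
  rewrite -catA strip_cat.
  have pbs' : perm_eq bs (rem b pend ++ vs ++ vs).
    rewrite -(perm_cons b); apply: perm_trans pbs _.
    by rewrite -cat_cons perm_cat2r perm_to_rem.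
  case np: (nilp _) => //=; apply: (IH _ _ _ _ pbs' nbs _ szv) => //.
  apply: contraFneq np => bs0; move/perm_size: pbs'.
  by rewrite bs0 size_cat => /esym/eqP; rewrite addn_eq0 => /andP [].
apply/orP; right.
have pvs := perm_to_rem bv.
have szr := size_rem bv.
have pbs' : perm_eq bs ((b :: pend) ++ rem b vs ++ rem b vs).
  rewrite -(perm_cons b); apply: perm_trans pbs _.
  apply: (@perm_trans _ (pend ++ (b :: rem b vs) ++ (b :: rem b vs))).
    by rewrite perm_cat2l perm_cat.
  apply/permP => P; rewrite /= !count_cat /= count_cat /=; lia.
case: n szv => [|n] szv; first by case: (vs) bv szv.
have [x [y ebs]] : exists x y, flatten bs = x ++ b ++ y.
  have : b \in bs by rewrite (perm_mem pbs') mem_head.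
  by case/splitPr => b1 b2; exists (flatten b1), (flatten b2); rewrite flatten_cat.
rewrite -catA; apply: grow_cat => //.
  by rewrite ebs -!catA head_annot.
apply: (IH _ _ _ _ pbs' nbs) => //.
  by case: (bs) pbs' => // /perm_size.
by rewrite szr; case: (vs) szv.
Qed.

(** * Windows of infinite words *)

Section Windows.

Variable T : Type.
Implicit Types (f : nat -> T) (i m q : nat).

Definition window f i m : seq T := [seq f k | k <- iota i m].

Lemma size_window f i m : size (window f i m) = m.
Proof. by rewrite size_map size_iota. Qed.

Lemma nth_window x0 f i m k : k < m -> nth x0 (window f i m) k = f (i + k).
Proof. by move=> lt; rewrite (nth_map 0) ?size_iota // nth_iota. Qed.

Lemma window_cat f i m k :
  window f i (m + k) = window f i m ++ window f (i + m) k.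
Proof. by rewrite /window iotaD map_cat. Qed.

Lemma window_take_drop f i m k n : k + n <= m ->
  window f (i + k) n = take n (drop k (window f i m)).
Proof.
move=> le; rewrite -(subnKC le) -addnA !window_cat drop_size_cat ?size_window //.
by rewrite take_size_cat ?size_window.
Qed.

Lemma eq_window f i j m n : n <= m ->
  window f i m = window f j m -> window f i n = window f j n.
Proof.
move=> le e; rewrite -[i]addn0 -[j]addn0 !(@window_take_drop f _ m 0 n) //.
by rewrite e.
Qed.

Lemma eq_windowP f i j m :
  window f i m = window f j m <-> forall k, k < m -> f (i + k) = f (j + k).
Proof.
split=> [e k lt|e]; first by rewrite -!(nth_window (f 0) _ _ lt) e.
apply: (@eq_from_nth _ (f 0)); rewrite !size_window // => k lt.
by rewrite !nth_window // e.
Qed.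

End Windows.

Lemma window_blocks (T : Type) (f : nat -> T) (B : nat -> seq T) q i m :
  (forall k, window f (q * k) q = B k) ->
  window f (q * i) (q * m) = flatten (window B i m).
Proof.
move=> fB; elim: m i => [|m IH] i; first by rewrite muln0.
by rewrite mulnS window_cat fB -mulnSr IH.
Qed.

(** * A binary word with sparse repetitions *)

Definition zdigits : seq bool :=
  [:: false; false; false; true; false; false; false; true;
      false; false; false; true; true].

Fixpoint zrec fuel n : bool :=
  if fuel is k.+1 then zrec k (n %/ 13) (+) nth false zdigits (n %% 13)
  else false.

(** The parity of the number of digits of [n] in base 13 that are 3, 7, 11 or
    12; this is the fixed point of the morphism [zblock]. *)
Definition zbit n := zrec n n.

Lemma zrec_fuel k n : n <= k -> zrec k n = zbit n.
Proof.
have [m] := ubnP n; elim: m n k => // m IH n k ltn le.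
case: n ltn le => [_ _|n ltn].
  by elim: k => //= k; rewrite div0n => ->.
case: k => // k le; rewrite /zbit /=; congr (_ (+) _).
have lt : n.+1 %/ 13 <= n by rewrite -ltnS ltn_Pdiv.
by rewrite !IH //; lia.
Qed.

Definition zblock a : seq bool := [seq a (+) d | d <- zdigits].

Lemma zbitE n : zbit n = zbit (n %/ 13) (+) nth false zdigits (n %% 13).
Proof.
case: n => // n; rewrite {1}/zbit /= zrec_fuel //.
by rewrite -ltnS ltn_Pdiv.
Qed.

Lemma window_zblock k : window zbit (13 * k) 13 = zblock (zbit k).
Proof.
apply: (@eq_from_nth _ false); first by rewrite size_window.
move=> t; rewrite size_window => lt.
rewrite nth_window // zbitE mulnC divnMDl // modnMDl divn_small // addn0.
by rewrite modn_small // (nth_map false).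
Qed.

Definition zpairs :=
  [seq zblock a ++ zblock b | a <- [:: true; false], b <- [:: true; false]].

Lemma window_zpairs k : window zbit (13 * k) 26 \in zpairs.
Proof.
rewrite (@window_blocks _ zbit (zblock \o zbit) 13 k 2 window_zblock) /window /=.
by case: (zbit k); case: (zbit k.+1).
Qed.

Lemma zsync_check :
  all (fun s => all (fun s' => all (fun o => all (fun o' =>
    (take 10 (drop o s) == take 10 (drop o' s')) ==> (o == o'))
    (iota 0 13)) (iota 0 13)) zpairs) zpairs.
Proof. by vm_compute. Qed.

Lemma zbit_sync i j : window zbit i 10 = window zbit j 10 -> i = j %[mod 13].
Proof.
have sub k : exists2 s, s \in zpairs
    & window zbit k 10 = take 10 (drop (k %% 13) s).
  exists (window zbit (13 * (k %/ 13)) 26); first exact: window_zpairs.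
  rewrite -window_take_drop; last by have := ltn_pmod k (isT : 0 < 13); lia.
  by rewrite mulnC -divn_eq.
have [s hs ->] := sub i; have [s' hs' ->] := sub j => e.
have io k : k %% 13 \in iota 0 13 by rewrite mem_iota ltn_pmod.
move/allP/(_ s hs)/allP/(_ s' hs')/allP/(_ _ (io i))/allP/(_ _ (io j)): zsync_check.
by rewrite e eqxx => /eqP.
Qed.

Definition zquads := [seq flatten [seq zblock b | b <- s] | s <- zpairs].

Lemma window_zquads k : window zbit (169 * k) 338 \in zquads.
Proof.
apply/mapP; exists (window zbit (13 * k) 26); first exact: window_zpairs.
rewrite -map_comp -(@window_blocks _ zbit (zblock \o zbit) 13 (13 * k) 26 window_zblock).
by rewrite mulnA.
Qed.

Lemma zshort_check :
  all (fun s => all (fun o => all (fun p =>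
    take (p %/ 4) (drop o s) != take (p %/ 4) (drop (o + p) s))
    [:: 12; 24; 36]) (iota 0 169)) zquads.
Proof. by vm_compute. Qed.

(** If 13 divides [p], the blocks met by the repetition have equal parents,
    since the two possible blocks differ everywhere, and the distance [p %/ 13]
    is again divisible by 12. Otherwise [l < 10] by [zbit_sync], which leaves
    the distances 12, 24 and 36. *)
Lemma zbit_run i p l : 0 < p -> 12 %| p ->
  window zbit i l = window zbit (i + p) l -> 4 * l + 4 <= p.
Proof.
have [n] := ubnP p; elim: n i p l => // n IH i p l ltn p0 d12 e.
have [d13|nd13] := boolP (13 %| p).
  case: l => [|l] in e *; first by have := dvdn_leq p0 d12; lia.
  have {d13} [p1 Dp] : exists p1, p = 13 * p1.
    by exists (p %/ 13); rewrite mulnC divnK.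
  have d12' : 12 %| p1 by move: d12; rewrite Dp Gauss_dvdr.
  pose l1 := (i + l) %/ 13 - i %/ 13 + 1.
  have e1 : window zbit (i %/ 13) l1 = window zbit (i %/ 13 + p1) l1.
    apply/eq_windowP => k ltk.
    have [t [t1 t2 t3]] : exists t, [/\ i <= t, t <= i + l & t %/ 13 = i %/ 13 + k].
      exists (maxn i (13 * (i %/ 13 + k))); rewrite leq_maxl geq_max; split=> //.
        by move: ltk; rewrite /l1; lia.
      by lia.
    have : zbit t = zbit (p + t).
      have := (eq_windowP _ _ _ _).1 e (t - i).
      by rewrite addnAC subnKC // addnC => -> //; lia.
    rewrite zbitE [zbit (p + t)]zbitE Dp mulnC divnMDl // modnMDl t3.
    by rewrite addnCA addnA => /addIb.
  have := IH (i %/ 13) p1 l1 _ _ d12' e1; rewrite /l1.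
  by move: p0 ltn; rewrite Dp; lia.
have l10 : l < 10.
  rewrite ltnNge; apply/negP => /(@eq_window _ _ _ _ _ _)/(_ e)/zbit_sync.
  move=> em; case/negP: nd13.
  have := em => /eqP; rewrite -{1}[i]addn0 eqn_modDl mod0n => /eqP h.
  by rewrite /dvdn -h.
rewrite leqNgt; apply/negP => gt.
have [k Dp] : exists k, p = 12 * k by exists (p %/ 12); rewrite mulnC divnK.
have pin : p \in [:: 12; 24; 36].
  have : k < 4 by lia.
  by case: k Dp p0 => [|[|[|[|k]]]] -> //; lia.
have le : p %/ 4 <= l by lia.
have io : i %% 169 \in iota 0 169 by rewrite mem_iota ltn_pmod.
move/allP/(_ _ (window_zquads (i %/ 169)))/allP/(_ _ io)/allP/(_ _ pin): zshort_check.
have bnd := ltn_pmod i (isT : 0 < 169).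
rewrite -!window_take_drop; try lia.
rewrite addnA [169 * _]mulnC -divn_eq (eq_window le e).
by rewrite eqxx.
Qed.

(** * The quaternary word *)

(** Two blocks for each residue modulo 12, found by a computer search. They are
    chosen so that [locate_check], [run_check] and [doubled_check] succeed and
    that the two blocks of each pair differ at position 26. *)
Definition blocks : seq (seq nat * seq nat) := [::
  ([:: 2; 3; 1; 0; 1; 3; 2; 1; 2; 0; 2; 3; 0; 1; 0; 2; 0; 3; 2; 0; 2; 1; 2; 3; 0;
    2; 0; 1; 0; 3; 2; 1; 2; 0; 1; 2; 3; 1; 0; 2; 1; 3; 2; 1; 2; 0; 3; 1; 2; 3],
   [:: 2; 3; 1; 0; 1; 3; 2; 1; 2; 0; 2; 1; 3; 0; 1; 0; 2; 1; 0; 3; 2; 1; 2; 0; 1;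
    2; 1; 3; 1; 2; 1; 0; 1; 3; 2; 3; 1; 3; 0; 2; 1; 3; 2; 1; 2; 0; 3; 1; 2; 3]);
  ([:: 1; 3; 0; 1; 2; 3; 2; 1; 2; 0; 1; 3; 1; 0; 2; 0; 3; 1; 3; 0; 2; 3; 1; 0; 1;
    3; 1; 2; 0; 3; 0; 1; 3; 0; 2; 3; 0; 3; 1; 0; 3; 2; 0; 1; 3; 1; 0; 1; 2; 3],
   [:: 1; 3; 0; 1; 2; 3; 2; 1; 2; 0; 1; 3; 1; 0; 2; 0; 3; 1; 3; 0; 3; 2; 3; 0; 1;
    0; 3; 0; 2; 1; 3; 1; 0; 1; 2; 0; 3; 0; 1; 0; 2; 0; 1; 0; 3; 1; 0; 1; 2; 3]);
  ([:: 0; 1; 3; 0; 3; 2; 1; 0; 1; 3; 1; 2; 0; 2; 1; 2; 3; 0; 1; 2; 0; 1; 0; 3; 2;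
    1; 2; 0; 2; 3; 0; 1; 0; 2; 1; 0; 1; 3; 2; 0; 1; 0; 3; 1; 0; 2; 1; 3; 0; 3],
   [:: 0; 1; 3; 0; 3; 2; 1; 0; 1; 3; 1; 0; 2; 3; 0; 1; 0; 3; 2; 3; 1; 0; 1; 3; 2;
    1; 0; 3; 0; 1; 0; 2; 3; 1; 3; 0; 1; 3; 2; 0; 1; 0; 3; 1; 0; 2; 1; 3; 0; 3]);
  ([:: 1; 3; 2; 0; 1; 3; 1; 2; 3; 1; 0; 2; 3; 2; 1; 3; 2; 3; 0; 3; 1; 2; 0; 2; 3;
    0; 2; 1; 3; 0; 3; 2; 0; 3; 0; 1; 2; 3; 0; 2; 3; 2; 1; 0; 3; 0; 2; 0; 1; 3],
   [:: 1; 3; 2; 0; 1; 3; 1; 2; 3; 1; 3; 0; 3; 2; 1; 3; 1; 0; 1; 2; 3; 2; 1; 2; 0;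
    3; 1; 2; 1; 0; 2; 1; 3; 0; 2; 0; 1; 2; 0; 2; 3; 2; 1; 0; 3; 0; 2; 0; 1; 3]);
  ([:: 1; 0; 1; 2; 0; 3; 0; 2; 1; 2; 3; 0; 3; 2; 3; 1; 3; 2; 0; 2; 1; 2; 3; 1; 2;
    1; 0; 1; 2; 1; 3; 1; 0; 2; 1; 2; 3; 2; 0; 1; 3; 1; 2; 3; 1; 0; 3; 1; 3; 2],
   [:: 1; 0; 1; 2; 0; 3; 0; 2; 1; 2; 3; 0; 3; 2; 3; 1; 3; 2; 0; 2; 1; 2; 3; 1; 0;
    1; 2; 1; 3; 1; 2; 1; 0; 2; 1; 2; 3; 2; 0; 1; 3; 1; 2; 3; 1; 0; 3; 1; 3; 2]);
  ([:: 1; 3; 0; 1; 2; 3; 2; 1; 2; 0; 3; 1; 3; 2; 3; 0; 1; 2; 1; 3; 1; 0; 3; 2; 3;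
    1; 3; 0; 3; 1; 3; 2; 1; 3; 1; 0; 1; 2; 3; 2; 1; 2; 0; 2; 1; 3; 1; 0; 2; 0],
   [:: 1; 3; 0; 1; 2; 3; 2; 1; 2; 0; 3; 1; 3; 2; 3; 0; 1; 2; 1; 3; 1; 0; 2; 3; 2;
    1; 2; 3; 0; 3; 2; 3; 1; 0; 2; 0; 3; 0; 1; 3; 2; 3; 1; 0; 1; 3; 1; 0; 2; 0]);
  ([:: 1; 3; 0; 3; 2; 3; 0; 1; 0; 2; 0; 3; 1; 3; 0; 3; 2; 1; 0; 3; 0; 2; 3; 0; 3;
    1; 2; 3; 2; 0; 3; 2; 3; 1; 0; 3; 0; 2; 0; 1; 2; 3; 2; 1; 0; 1; 2; 1; 0; 3],
   [:: 1; 3; 0; 3; 2; 3; 0; 1; 0; 2; 0; 3; 0; 2; 0; 1; 2; 0; 2; 3; 2; 1; 0; 1; 2;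
    1; 3; 0; 2; 1; 0; 2; 0; 3; 1; 2; 1; 0; 1; 3; 2; 3; 1; 3; 0; 1; 2; 1; 0; 3]);
  ([:: 0; 2; 1; 2; 0; 2; 1; 3; 1; 2; 0; 1; 0; 3; 0; 1; 2; 1; 3; 1; 0; 1; 3; 1; 2;
    3; 1; 3; 0; 2; 1; 3; 2; 1; 2; 0; 3; 1; 3; 2; 3; 0; 2; 1; 2; 3; 1; 2; 1; 0],
   [:: 0; 2; 1; 2; 0; 2; 1; 3; 1; 2; 0; 1; 0; 3; 0; 2; 3; 1; 3; 0; 3; 2; 0; 3; 0;
    1; 3; 2; 3; 0; 2; 3; 2; 1; 0; 3; 2; 3; 1; 3; 2; 0; 2; 1; 2; 3; 1; 2; 1; 0]);
  ([:: 2; 3; 2; 1; 3; 2; 3; 0; 1; 3; 1; 2; 3; 1; 3; 0; 3; 2; 1; 3; 1; 0; 1; 2; 0;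
    3; 0; 2; 1; 2; 3; 0; 3; 2; 3; 0; 1; 0; 3; 2; 0; 2; 1; 2; 3; 1; 0; 1; 2; 0],
   [:: 2; 3; 2; 1; 3; 2; 3; 0; 1; 2; 3; 2; 0; 2; 3; 1; 3; 0; 3; 2; 1; 2; 3; 2; 0;
    3; 1; 3; 0; 2; 0; 1; 3; 1; 0; 1; 2; 1; 0; 3; 0; 1; 0; 2; 3; 1; 0; 1; 2; 0]);
  ([:: 1; 0; 3; 2; 1; 0; 2; 1; 2; 3; 0; 1; 0; 2; 0; 3; 2; 0; 2; 1; 3; 0; 2; 0; 1;
    2; 0; 3; 2; 1; 0; 1; 2; 1; 3; 0; 2; 1; 2; 3; 1; 2; 0; 1; 3; 2; 1; 0; 2; 1],
   [:: 1; 0; 3; 2; 1; 0; 1; 3; 1; 0; 2; 3; 0; 1; 3; 0; 3; 2; 0; 3; 1; 0; 3; 0; 2;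
    1; 3; 1; 0; 1; 3; 2; 3; 1; 3; 0; 2; 1; 2; 3; 1; 2; 0; 1; 3; 2; 1; 0; 2; 1]);
  ([:: 2; 3; 0; 1; 2; 1; 3; 1; 2; 0; 3; 2; 1; 3; 2; 3; 0; 1; 2; 3; 2; 0; 3; 2; 3;
    1; 0; 2; 3; 2; 1; 3; 2; 0; 1; 3; 1; 2; 3; 1; 0; 3; 1; 3; 2; 1; 3; 0; 1; 3],
   [:: 2; 3; 0; 1; 2; 1; 3; 1; 2; 0; 2; 3; 2; 1; 3; 2; 3; 0; 3; 2; 3; 1; 3; 0; 2;
    3; 2; 1; 2; 0; 3; 0; 2; 0; 3; 1; 3; 2; 3; 0; 1; 0; 3; 0; 2; 1; 3; 0; 1; 3]);
  ([:: 1; 2; 0; 3; 0; 1; 0; 3; 2; 1; 3; 0; 3; 1; 2; 1; 0; 3; 0; 1; 2; 0; 2; 3; 2;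
    0; 1; 0; 3; 0; 2; 1; 3; 1; 0; 1; 2; 3; 0; 3; 1; 3; 0; 2; 0; 3; 0; 1; 0; 3],
   [:: 1; 2; 0; 3; 0; 1; 0; 3; 2; 3; 0; 3; 1; 2; 0; 2; 3; 2; 1; 0; 3; 0; 2; 0; 3;
    1; 3; 0; 3; 2; 1; 0; 1; 3; 0; 1; 2; 3; 0; 3; 1; 3; 0; 2; 0; 3; 0; 1; 0; 3])].

Definition block c (b : bool) : seq nat :=
  let: (u, v) := nth ([::], [::]) blocks (c %% 12) in if b then v else u.

Definition letter n := nth 0 (block (n %/ 50) (zbit (n %/ 50))) (n %% 50).

Lemma size_block c b : size (block c b) = 50.
Proof.
have /allP ok : all (fun c => (size (block c false) == 50) && (size (block c true) == 50))
    (iota 0 12) by vm_compute.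
have := ok (c %% 12); rewrite mem_iota ltn_pmod // => /(_ isT).
by rewrite /block modn_mod => /andP [/eqP h1 /eqP h2]; case: b.
Qed.

Lemma block_mod c b : block (c %% 12) b = block c b.
Proof. by rewrite /block modn_mod. Qed.

Lemma window_block k : window letter (50 * k) 50 = block k (zbit k).
Proof.
apply: (@eq_from_nth _ 0); first by rewrite size_window size_block.
move=> t; rewrite size_window => lt.
by rewrite nth_window // /letter mulnC divnMDl // divn_small // addn0 modnMDl modn_small.
Qed.

Definition contexts2 c :=
  [seq block c b0 ++ block c.+1 b1 | b0 <- [:: true; false], b1 <- [:: true; false]].

Definition contexts3 c :=
  [seq block c b ++ s | b <- [:: true; false], s <- contexts2 c.+1].

Lemma window_contexts2 k : window letter (50 * k) 100 \in contexts2 k.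
Proof.
rewrite (@window_blocks _ letter (fun k => block k (zbit k)) 50 k 2 window_block).
rewrite /= cats0; apply/allpairsP; exists (zbit k, zbit k.+1) => /=.
by split=> //; case: zbit.
Qed.

Lemma window_contexts3 k : window letter (50 * k) 150 \in contexts3 k.
Proof.
rewrite (@window_cat _ letter (50 * k) 50 100) window_block -mulnSr.
apply/allpairsP; exists (zbit k, window letter (50 * k.+1) 100) => /=.
by split=> //; [case: zbit | exact: window_contexts2].
Qed.

Lemma block_modD c m b : block (c %% 12 + m) b = block (c + m) b.
Proof. by rewrite -block_mod modnDml block_mod. Qed.

Lemma contexts2_mod c : contexts2 (c %% 12) = contexts2 c.
Proof.
have := (block_modD c 0, block_modD c 1); rewrite !addn0 !addn1 => -[e0 e1].
by rewrite /contexts2 /= !e0 !e1.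
Qed.

Lemma contexts3_mod c : contexts3 (c %% 12) = contexts3 c.
Proof.
have := (block_modD c 0, block_modD c 1, block_modD c 2).
rewrite !addn0 !addn1 !addn2 => -[[e0 e1] e2].
by rewrite /contexts3 /contexts2 /= !e0 !e1 !e2.
Qed.

(** Reduces a property of all windows of [letter] to the finitely many triples
    of consecutive blocks. *)
Lemma all_contexts3 (P : seq nat -> bool) :
  all (fun c => all P (contexts3 c)) (iota 0 12) ->
  forall i, exists2 s, P s & forall o n, i %% 50 + o + n <= 150 ->
    window letter (i + o) n = take n (drop (i %% 50 + o) s).
Proof.
move=> /allP ok i; exists (window letter (50 * (i %/ 50)) 150).
  have c12 : (i %/ 50) %% 12 \in iota 0 12 by rewrite mem_iota ltn_pmod.
  have /allP := ok _ c12; apply; rewrite contexts3_mod.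
  exact: window_contexts3.
move=> o n le; rewrite -window_take_drop //.
by rewrite addnA mulnC -divn_eq.
Qed.

(** A dictionary from words over the letters 0 to 3 to positions (residue of the
    block index modulo 12, offset in the block). Only [lookup] matters for the
    proofs: that it is a function of the word makes windows with different
    positions different. *)
Inductive trie := Leaf of option (nat * nat) | Node of trie & trie & trie & trie.

Definition children t :=
  if t is Node t0 t1 t2 t3 then (t0, t1, t2, t3)
  else let e := Leaf None in (e, e, e, e).

Fixpoint insert w r t : trie :=
  if w is a :: w' then
    let: (t0, t1, t2, t3) := children t in
    match a with
    | 0 => Node (insert w' r t0) t1 t2 t3
    | 1 => Node t0 (insert w' r t1) t2 t3
    | 2 => Node t0 t1 (insert w' r t2) t3
    | _ => Node t0 t1 t2 (insert w' r t3)
    end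
  else Leaf (Some r).

Fixpoint lookup w t : option (nat * nat) :=
  match w, t with
  | a :: w', Node t0 t1 t2 t3 =>
    lookup w' (match a with 0 => t0 | 1 => t1 | 2 => t2 | _ => t3 end)
  | [::], Leaf r => r
  | _, _ => None
  end.

Definition located : seq (seq nat * (nat * nat)) :=
  flatten [seq flatten [seq [seq (take 19 (drop o s), (c, o)) | o <- iota 0 50]
    | s <- contexts2 c] | c <- iota 0 12].

Definition locate : trie := foldr (fun x => insert x.1 x.2) (Leaf None) located.

(* The abstraction over [t] makes evaluation build the dictionary only once. *)
Lemma locate_check : (fun t => all (fun x => lookup x.1 t == Some x.2) located) locate.
Proof. by vm_compute. Qed.

Lemma locateP i :
  lookup (window letter i 19) locate = Some ((i %/ 50) %% 12, i %% 50).
Proof.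
have /allP := locate_check.
move=> /(_ (window letter i 19, ((i %/ 50) %% 12, i %% 50))) h.
apply/eqP; apply: h; apply/flattenP.
exists (flatten [seq [seq (take 19 (drop o s), ((i %/ 50) %% 12, o)) | o <- iota 0 50]
    | s <- contexts2 ((i %/ 50) %% 12)]).
  by apply/mapP; exists ((i %/ 50) %% 12) => //; rewrite mem_iota ltn_pmod.
apply/flatten_mapP; exists (window letter (50 * (i %/ 50)) 100).
  by rewrite contexts2_mod window_contexts2.
apply/mapP; exists (i %% 50); first by rewrite mem_iota ltn_pmod.
congr (_, _); rewrite -window_take_drop; last by have := ltn_pmod i (isT : 0 < 50); lia.
by rewrite mulnC -divn_eq.
Qed.

Lemma letter_sync i p : window letter i 19 = window letter (i + p) 19 ->
  exists2 p1, p = 50 * p1 & 12 %| p1.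
Proof.
move=> /(congr1 (lookup^~ locate)); rewrite !locateP => -[ec eo].
have d50 : 50 %| p.
  by move/eqP: eo; rewrite -{1}[i]addn0 eqn_modDl mod0n eq_sym.
exists (p %/ 50); first by rewrite mulnC divnK.
move: ec; rewrite divnDr // => /eqP.
by rewrite -{1}[i %/ 50]addn0 eqn_modDl mod0n eq_sym.
Qed.

Lemma marker c : nth 0 (block c true) 26 != nth 0 (block c false) 26.
Proof.
have /allP ok : all (fun c => nth 0 (block c true) 26 != nth 0 (block c false) 26)
    (iota 0 12) by vm_compute.
by have := ok (c %% 12); rewrite !block_mod mem_iota ltn_pmod //; apply.
Qed.

(** A factor of length [l] contains position 26 of [l1] consecutive blocks,
    where [50 * l1 + 49 >= l], and these letters determine the bits. The
    margin 4 in [zbit_run] absorbs the 49 letters. *)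
Lemma letter_synced_run i p l : 0 < p -> 12 %| p ->
  window letter i l = window letter (i + 50 * p) l -> 4 * l < 50 * p.
Proof.
move=> p0 d12 e.
(* The first block index [k] with [i <= 50 * k + 26]. *)
pose k0 := (i + 23) %/ 50.
pose l1 := (i + l + 23) %/ 50 - k0.
suff : 4 * l1 + 4 <= p by rewrite /l1 /k0; lia.
apply: (@zbit_run k0) => //; apply/eq_windowP => k ltk.
have := (eq_windowP _ _ _ _).1 e (50 * (k0 + k) + 26 - i).
rewrite addnAC subnKC; last by rewrite /k0; lia.
move=> /(_ _)/wrap [|]; first by move: ltk; rewrite /l1 /k0; lia.
rewrite addnAC -mulnDr /letter ![50 * _]mulnC !divnMDl // !addn0 !modnMDl.
have -> : block (k0 + k + p) =1 block (k0 + k).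
  by move=> b; rewrite -block_mod -modnDmr (eqP d12) addn0 block_mod.
rewrite addnAC; have := marker (k0 + k).
by case: (zbit (k0 + k)); case: (zbit _) => //= /eqP // h /esym.
Qed.

(** * Repetitions and doubled factors of the quaternary word *)

Fixpoint agree n (u v : seq nat) : bool :=
  match n, u, v with
  | 0, _, _ => true
  | n'.+1, a :: u', b :: v' => if a == b then agree n' u' v' else false
  | _, _, _ => false
  end.

Lemma agree_take n u v : n <= size u -> take n u = take n v -> agree n u v.
Proof.
elim: n u v => [|n IH] [|a u] // [|b v] //= le [-> e].
by rewrite eqxx IH.
Qed.

(** [n] distances are tested, from [p] on, with [v] the suffix of [u] at distance
    [p]. The tested length is the least [l >= 6] with [p <= 4 * l]. *)
Fixpoint no_run n p u v : bool :=
  if n is n'.+1 then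
    if agree (maxn 6 ((p + 3) %/ 4)) u v then false
    else no_run n' p.+1 u (behead v)
  else true.

Fixpoint all_tails (T : Type) (P : seq T -> bool) n s : bool :=
  if n is n'.+1 then if P s then all_tails P n' (behead s) else false else true.

Lemma all_tailsP (T : Type) (P : seq T -> bool) n s o : all_tails P n s -> o < n -> P (drop o s).
Proof.
elim: n s o => // n IH s o /=; case: ifP => // Ps al.
case: o => [|o] lt; first by rewrite drop0.
by rewrite -addn1 -drop_drop drop1; apply: IH.
Qed.

Lemma no_runP n p u v d : no_run n p u v -> d < n ->
  ~~ agree (maxn 6 ((p + d + 3) %/ 4)) u (drop d v).
Proof.
elim: n p v d => // n IH p v d /=; case: ifP => // na nr.
case: d => [|d] lt; first by rewrite addn0 drop0 na.
rewrite -[p + _]addSnnS -[d.+1]addn1 -drop_drop drop1; exact: IH.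
Qed.

Lemma run_check :
  all (fun c => all (all_tails (fun u => no_run 72 1 u (behead u)) 50) (contexts3 c))
    (iota 0 12).
Proof. by vm_compute. Qed.

(** Repetitions of length at least 19 are synchronized and come from the bits;
    the shorter ones with [p <= 4 * l] have [p <= 72] and lie in three blocks. *)
Lemma letter_run i p l : 0 < p -> 5 < l ->
  window letter i l = window letter (i + p) l -> 4 * l < p.
Proof.
move=> p0 l6 e.
have [l19|l19] := leqP 19 l.
  have [p1 Dp d12] := letter_sync (eq_window l19 e).
  by rewrite Dp in e p0 *; apply: (@letter_synced_run i) => //; lia.
rewrite ltnNge; apply/negP => le.
have [s ok win] := all_contexts3 run_check i.
have io := ltn_pmod i (isT : 0 < 50).
have p72 : p.-1 < 72 by lia.
have := no_runP (all_tailsP ok io) p72.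
rewrite -drop1 !drop_drop addn1 prednK // add1n prednK // => /negP; apply.
set m := maxn _ _; have ml : m <= l by rewrite /m; lia.
have m18 : m <= 18 by lia.
have := eq_window ml e; rewrite -{1}[i]addn0 !win; try lia.
rewrite addn0 addnC => em; apply: agree_take em.
have := win 0 m; rewrite !addn0 => /(_ _)/wrap [|/(congr1 size)]; first lia.
by rewrite size_window size_take_min => {1}->; exact: geq_minr.
Qed.

(* Fuel 8 suffices: four variables make at most eight blocks. *)
Lemma doubled_check :
  all (fun c => all (fun s =>
      all_tails (fun u => ~~ starts_doubled 8 4 [::] u) 50 (annot s))
    (contexts3 c)) (iota 0 12).
Proof. by vm_compute. Qed.

Lemma doubled_window_short i m : doubled 4 (window letter i m) -> m <= 100.
Proof.
move=> /(doubled_matching 0) [x [per []]]; rewrite size_window => -> le lo occ.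
suff : \sum_j x j <= 50 by lia.
apply: (sum_le50 le lo) => j x6; have [a bnd eqx] := occ j.
apply: (@letter_run (i + a)) => //; first by have := lo j; lia.
apply/eq_windowP => k ltk; have := eqx k ltk.
by rewrite !nth_window ?addnA //; lia.
Qed.

Lemma letter_no_doubled i m : doubled 4 (window letter i m) -> m = 0.
Proof.
move=> dbl; have m100 := doubled_window_short dbl.
have [bs [vs [ew pbs szv nbs]]] := doubled_nonempty dbl.
have [bs0|bs0] := eqVneq bs [::].
  by rewrite -(size_window letter i m) -ew bs0.
pose P s := all_tails (fun u => ~~ starts_doubled 8 4 [::] u) 50 (annot s).
have [s ok win] := all_contexts3 (P := P) doubled_check i.
have io := ltn_pmod i (isT : 0 < 50).
case/negP: (all_tailsP ok io); rewrite drop_annot.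
have := win 0 m; rewrite !addn0 => /(_ _)/wrap [|em]; first lia.
rewrite -(cat_take_drop m (drop _ s)) -em -ew.
apply: (@starts_doubledP bs [::] vs) => //.
by rewrite (perm_size pbs) size_cat; lia.
Qed.

Lemma letter_lt4 n : letter n < 4.
Proof.
have /allP ok : all (fun c => all (fun a => a < 4) (block c true) &&
    all (fun a => a < 4) (block c false)) (iota 0 12) by vm_compute.
have := ok ((n %/ 50) %% 12); rewrite !block_mod mem_iota ltn_pmod // => /(_ isT).
rewrite /letter => /andP [/all_nthP h1 /all_nthP h2].
by case: zbit; [apply: h1 | apply: h2]; rewrite size_block ltn_pmod.
Qed.

Lemma letter_avoids4 : avoids_ktangrams 4 (fun n => inord (letter n) : 'I_4).
Proof.
move=> m l [[w0 _] [c [[c1 /cuts_doubled dbl] _] c4]].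
case: w0; suff -> : l = 0 by [].
apply: (@letter_no_doubled m).
have -> : window letter m l = map val (factor (fun n => inord (letter n) : 'I_4) m l).
  by rewrite -map_comp; apply: eq_map => n /=; rewrite inordK // letter_lt4.
apply: doubled_map; have [bs [vs [ew pbs szv]]] := dbl.
by exists bs, vs; split=> //; apply: leq_trans szv c4.
Qed.

(** * Ternary words contain 3-tangrams *)

Lemma splits_tangram (A : finType) (w : seq A) c :
  w <> [::] -> splits_with_cuts w c -> tangram w.
Proof.
move=> w0 [ps [qs [_ _ ew pqp [j _ eqh]]]]; split=> // a; rewrite -ew.
have <- := permP (perm_flatten pqp) (pred1 a).
rewrite -(cat_take_drop j qs) flatten_cat.
by rewrite count_cat eqh addnn odd_double.
Qed.

(** Cut numbers are minima over a predicate that is not given as decidable; a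
    double negation of their existence is enough for refutations. *)
Lemma least_nn (P : nat -> Prop) c : P c ->
  ~ (forall c', is_least P c' -> c' <= c -> False).
Proof.
have [n] := ubnP c; elim: n c => // n IH c ltc Pc H.
apply: (H c) => //; split=> // m Pm; rewrite leqNgt; apply/negP => ltm.
apply: (IH m) => // [|c' lc' le']; first by lia.
by apply: H lc' _; lia.
Qed.

Definition square_prefix (T : eqType) p (w : seq T) : bool :=
  (p.*2 <= size w) && (take p w == take p (drop p w)).

(** The three equality tests are the shapes abacbc, abcacb and abcbac. Period 4
    is there for the periodic word abacabacabac, which contains none of the
    shorter squares and none of the three shapes. *)
Definition tangram_prefix (T : eqType) (w : seq T) : bool :=
  has (fun p => square_prefix p w) [:: 1; 2; 3; 4]
  || (if w is [:: a, b, c, d, e, f & _] then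
        [|| [&& a == c, b == e & d == f],
            [&& a == d, b == f & c == e]
          | [&& a == e, b == d & c == f]]
      else false).

Lemma tangram_prefix_map (T S : eqType) (g : T -> S) (w : seq T) :
  injective g -> tangram_prefix (map g w) = tangram_prefix w.
Proof.
move=> gI; congr (_ || _).
  apply: eq_has => p; rewrite /square_prefix size_map -map_drop -!map_take.
  by rewrite (inj_eq (inj_map gI)).
by case: w => [|? [|? [|? [|? [|? [|? ?]]]]]] //=; rewrite !(inj_eq gI).
Qed.

Lemma tangram_prefixP (A : finType) (w : seq A) : tangram_prefix w ->
  exists l, [/\ take l w <> [::], l <= size w
    & exists2 c, 1 <= c <= 3 & splits_with_cuts (take l w) c].
Proof.
case/orP => [/hasP [p p4 /andP [le /eqP sq]]|].
  have p0 : 0 < p by move: p4; case: (p).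
  have n0 : take p w != [::] by rewrite -size_eq0 size_take_min; lia.
  exists p.*2; split=> //; last exists 1 => //.
    by apply/eqP; rewrite -size_eq0 size_take_min; lia.
  exists [:: take p w; take p w], [:: take p w; take p w]; split=> //.
  - by rewrite !inE eq_sym orbb.
  - by rewrite /= cats0 {2}sq -addnn takeD.
  by exists 1; rewrite //= cats0.
case: w => [|a [|b [|c [|d [|e [|f w]]]]]] // H.
exists 6; split=> //; exists 3 => //; rewrite [take _ _]/= take0.
(* The shapes abacbc, abcacb, abcbac: ab.c = a.bc, then abc = a.b.c twice. *)
case/or3P: H => /and3P [/eqP -> /eqP -> /eqP ->].
- exists [:: [:: c; e]; [:: c]; [:: f]; [:: e; f]],
    [:: [:: c; e]; [:: f]; [:: c]; [:: e; f]]; split=> //.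
    by apply/permP => P /=; lia.
  by exists 2.
- exists [:: [:: d; f; e]; [:: d]; [:: e]; [:: f]],
    [:: [:: d; f; e]; [:: d]; [:: f]; [:: e]]; split=> //.
    by apply/permP => P /=; lia.
  by exists 1.
exists [:: [:: e; d; f]; [:: d]; [:: e]; [:: f]],
  [:: [:: e; d; f]; [:: e]; [:: d]; [:: f]]; split=> //.
  by apply/permP => P /=; lia.
by exists 1.
Qed.

(** Words are extended to the left, so that a new tangram is a prefix. *)
Fixpoint unavoidable n (w : seq nat) : bool :=
  tangram_prefix w ||
  (if n is n'.+1 then all (fun a => unavoidable n' (a :: w)) [:: 0; 1; 2] else false).

Lemma unavoidableP (u : nat -> nat) n i m : (forall k, u k < 3) -> n <= i ->
  unavoidable n (window u i m) -> exists j l, tangram_prefix (window u j l).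
Proof.
move=> u3; elim: n i m => [|n IH] i m le /= /orP [].
- by exists i, m.
- by [].
- by exists i, m.
case: i le => // i le al; apply: (IH i m.+1) => //.
have -> : window u i m.+1 = u i :: window u i.+1 m by [].
case/and4P: al => *; case: (u i) (u3 i) => [|[|[|]]] //.
Qed.

Lemma ternary_check : unavoidable 8 [::].
Proof. by vm_compute. Qed.

Lemma ternary_tangram m (x : nat -> 'I_m) : avoids_ktangrams 3 x -> 3 < m.
Proof.
move=> av; rewrite ltnNge; apply/negP => m3.
have u3 k : val (x k) < 3 by apply: leq_trans (ltn_ord _) m3.
have [j [l]] := @unavoidableP (fun k => val (x k)) 8 8 0 u3 isT ternary_check.
have -> : window (fun k => val (x k)) j l = map val (factor x j l).
  by rewrite -map_comp.
rewrite tangram_prefix_map; last exact: val_inj.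
move=> /tangram_prefixP [l' [w0 le [c c13 sp]]].
have ew : take l' (factor x j l) = factor x j l'.
  rewrite /factor -map_take take_iota; congr (map _ (iota _ _)).
  by move: le; rewrite size_map size_iota; lia.
rewrite ew in w0 sp.
pose P c' := 1 <= c' /\ splits_with_cuts (factor x j l') c'.
have Pc : P c by split=> //; case/andP: c13.
apply: (least_nn Pc) => c' lc' le'; apply: (av j l'); split.
  exact: splits_tangram sp.
by exists c' => //; case/andP: c13; lia.
Qed.
(** * The value of t(3) and t(4) *)

Theorem theorem2 : is_t 3 4 /\ is_t 4 4.
Proof.
have mono (A : finType) (x : nat -> A) : avoids_ktangrams 4 x -> avoids_ktangrams 3 x.
  by move=> av m l [tw [c cc c3]]; apply: (av m l); split=> //; exists c => //; lia.
have ex4 := letter_avoids4; split; split.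
- by eexists; apply: mono ex4.
- by move=> m [x]; apply: ternary_tangram.
- by eexists; exact: ex4.
- by move=> m [x /mono]; apply: ternary_tangram.
Qed.
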